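(* For integers $n,k$ with $n\geq k+1\geq 2$, the average $k$-alternating length of permutations in $\mathfrak{S}_n$ is $$E_n(as_k)=\frac{1}{n!}\sum_{w\in\mathfrak{S}_n} as_k(w)=\frac{4(n-k)+5}{6}.$$
   Context: $\mathfrak{S}_n$ is the set of permutations $w=w_1w_2\cdots w_n$ of $\{1,\dots,n\}$ (in one-line notation). A subsequence $w_{i_1}w_{i_2}\cdots w_{i_s}$ ($i_1<\dots<i_s$) of $w$ is alternating if $w_{i_1}>w_{i_2}<w_{i_3}>\cdots$ (inequalities alternate, starting with $>$). It is $k$-alternating if moreover $|w_{i_j}-w_{i_{j+1}}|\geq k$ for every $j$. The $k$-alternating length $as_k(w)$ is the maximal length (number of elements) of a $k$-alternating subsequence of $w$. *)

(* Defs.v *)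
From mathcomp Require Import all_boot all_order all_algebra all_fingroup.
Set Implicit Arguments. Unset Strict Implicit. Unset Printing Implicit Defensive.

(* Permutations of {1..n} are modelled as {perm 'I_n} (values 0..n-1); only
   comparisons and differences of values matter, so the shift is harmless. *)

Fixpoint kalt_from (k : nat) (down : bool) (s : seq nat) : bool :=
  match s with
  | x :: ((y :: _) as t) =>
      [&& (if down then y < x else x < y),
          (k <= (if down then x - y else y - x))
        & kalt_from k (~~ down) t]
  | _ => true
  end.

Definition k_alternating (k : nat) (s : seq nat) : bool := kalt_from k true s.

Definition subseq_at (n : nat) (w : {perm 'I_n}) (A : {set 'I_n}) : seq nat :=
  [seq (nat_of_ord (w i)) | i <- enum 'I_n & i \in A].

Definition as_k (n k : nat) (w : {perm 'I_n}) : nat :=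
  \max_(A : {set 'I_n} | k_alternating k (subseq_at w A)) #|A|.

(* Main.v *)
(* Scanning w greedily, a longest k-alternating subsequence is obtained by
   holding a current extreme value and turning whenever the scan has moved back
   by at least k. For a width K and a threshold a, consider the two-state
   relay that becomes "low" on values < a and "high" on values >= a + K, starts
   low, and is otherwise unchanged; let T_K(w) be its number of switches along w,
   summed over all a. At any time the relays that are high form an initial
   segment {a < c}, and the endpoint c is determined by the greedy state, both
   for K = k - 1 and for K = k; comparing the two evolutions step by step gives
   as_k(w) = T_(k-1)(w) - T_k(w).
   To average T_K, note that the relay at a sees only the a values below a and
   the N - a values above, where N = n - K, and in a random w these N values
   appear in uniformly random order. The expected number of switches is thus
   (N - a) (2 a + 1) / N, and the sum over a is (N + 1) (2 N + 1) / 6. Subtracting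
   the values at N = n - k + 1 and N = n - k gives (4 (n - k) + 5) / 6. *)
Require Import Defs.
From mathcomp Require Import all_boot all_order all_algebra all_fingroup.
From mathcomp Require Import zify.
Import GRing.Theory Num.Theory.
Set Implicit Arguments. Unset Strict Implicit. Unset Printing Implicit Defensive.

(** * Optimality of the greedy scan *)

(* In state [down = true] (resp. false), [m] is the current peak (resp. valley)
   and the next turn goes down (resp. up). *)
Fixpoint greedy (k : nat) (down : bool) (m : nat) (s : seq nat) : nat :=
  if s is y :: s' then
    if down then
      if y + k <= m then (greedy k false y s').+1 else greedy k true (maxn m y) s'
    else
      if m + k <= y then (greedy k true y s').+1 else greedy k false (minn m y) s'
  else 0.

(** A more extreme held value makes the next turn easier. The claims need a joint induction: when
    only one of two scans turns, they face opposite directions, and the third claim compares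
    them. *)
Lemma greedy_mono k s :
  [/\ forall m m', m <= m' -> greedy k true m s <= greedy k true m' s,
      forall m m', m' <= m -> greedy k false m s <= greedy k false m' s
    & forall d m m', greedy k d m s <= (greedy k (~~ d) m' s).+1].
Proof.
elim: s => [|y s [IHp IHv IHx]]; first by split.
split=> [m m' le_m|m m' le_m|[] m m'] /=.
- case: ifP => [h|_].
    by rewrite (_ : y + k <= m') //; lia.
  case: ifP => _; first exact: (IHx true).
  by apply: IHp; lia.
- case: ifP => [h|_].
    by rewrite (_ : m' + k <= y) //; lia.
  case: ifP => _; first exact: (IHx false).
  by apply: IHv; lia.
- case: ifP => _; case: ifP => _.
  + by rewrite ltnS; exact: (IHx false).
  + by rewrite ltnS; apply: IHv; lia.
  + by have := IHx true (maxn m y) y; have := IHx false y y; rewrite /=; lia.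
  + exact: (IHx true).
- case: ifP => _; case: ifP => _.
  + by rewrite ltnS; exact: (IHx true).
  + by rewrite ltnS; apply: IHp; lia.
  + by have := IHx false (minn m y) y; have := IHx true y y; rewrite /=; lia.
  + exact: (IHx false).
Qed.

(** The held value [m] is at least as extreme as the last chosen entry [p], so the scan turns
    whenever the subsequence does. At a skipped letter, monotonicity suffices. *)
Lemma greedy_ub k s :
  (forall m p t, subseq t s -> p <= m -> kalt_from k true (p :: t) ->
     size t <= greedy k true m s)
  /\ (forall m p t, subseq t s -> m <= p -> kalt_from k false (p :: t) ->
     size t <= greedy k false m s).
Proof.
elim: s => [|y s [IHp IHv]]; first by split=> m p [].
have [monop monov cross] := greedy_mono k s.
split=> m p [|x t] // sub le_pm /and3P[/= lt_xp le_k alt]; move: sub => /=.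
- case: (x =P y) => [xy sub|_ sub].
    subst x; rewrite (_ : y + k <= m); last by lia.
    by rewrite ltnS; apply: (IHv _ _ _ sub _ alt).
  have bnd : size (x :: t) <= greedy k true m s.
    by apply: (IHp _ _ _ sub le_pm); rewrite /= lt_xp le_k.
  apply: leq_trans bnd _; case: ifP => _; first exact: (cross true).
  by apply: monop; lia.
- case: (x =P y) => [xy sub|_ sub].
    subst x; rewrite (_ : m + k <= y); last by lia.
    by rewrite ltnS; apply: (IHp _ _ _ sub _ alt).
  have bnd : size (x :: t) <= greedy k false m s.
    by apply: (IHv _ _ _ sub le_pm); rewrite /= lt_xp le_k.
  apply: leq_trans bnd _; case: ifP => _; first exact: (cross false).
  by apply: monov; lia.
Qed.

Lemma k_alternating_greedy_ub k m s t :
  subseq t s -> k_alternating k t -> size t <= (greedy k true m s).+1.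
Proof.
case: t => // x t; elim: s m => // y s IHs m sub alt; rewrite /= ltnS.
have [monop _ cross] := greedy_mono k s.
move: sub => /=; case: (x =P y) => [xy sub|_ sub].
  subst x; have bnd : size t <= greedy k true y s.
    by apply: (proj1 (greedy_ub k s)) alt => //; lia.
  apply: leq_trans bnd _; case: ifP => _; first exact: (cross true).
  by apply: monop; lia.
case: ifP => _; last exact: IHs.
(* The turn just counted pays for the loss of at most one in changing direction. *)
by have := IHs 0 sub alt; have := cross true 0 y; rewrite /=; lia.
Qed.

(** The witness starts at some [p] beyond [m], because the held extreme may still move before the
    first turn; such a [p] can follow any entry that [m] could. *)
Lemma greedy_attained k s : 0 < k ->
  (forall m, exists p t, [/\ subseq (p :: t) (m :: s), m <= p,
     kalt_from k true (p :: t) & size t = greedy k true m s])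
  /\ (forall m, exists p t, [/\ subseq (p :: t) (m :: s), p <= m,
     kalt_from k false (p :: t) & size t = greedy k false m s]).
Proof.
move=> k0; elim: s => [|y s [IHp IHv]].
  by split=> m; exists m, [::]; rewrite /= eqxx.
split=> m.
- have [h|h] := leqP (y + k) m.
    have [p [t [sub le_p alt sz]]] := IHv y.
    exists m, (p :: t); split=> //; last by rewrite /= h -sz.
      by rewrite /= eqxx.
    by apply/and3P; split => //; lia.
  have [p [t [sub le_p alt sz]]] := IHp (maxn m y).
  exists p, t; split=> //; last by rewrite sz /= leqNgt h.
    apply: subseq_trans sub _; rewrite /maxn; case: ifP => _.
      exact: subseq_cons.
    by rewrite /= eqxx; exact: subseq_cons.
  by lia.
- have [h|h] := leqP (m + k) y.
    have [p [t [sub le_p alt sz]]] := IHp y.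
    exists m, (p :: t); split=> //; last by rewrite /= h -sz.
      by rewrite /= eqxx.
    by apply/and3P; split => //; lia.
  have [p [t [sub le_p alt sz]]] := IHv (minn m y).
  exists p, t; split=> //; last by rewrite sz /= leqNgt h.
    apply: subseq_trans sub _; rewrite /minn; case: ifP => _.
      by rewrite /= eqxx; exact: subseq_cons.
    exact: subseq_cons.
  by lia.
Qed.

Definition word n (w : {perm 'I_n}) : seq 'I_n := [seq w i | i <- enum 'I_n].

Lemma as_k_greedy n k (w : {perm 'I_n.+1}) : 0 < k ->
  as_k k w = (greedy k true 0 (map val (word w))).+1.
Proof.
move=> k0; set s := map val _.
have size_at A : size (subseq_at w A) = #|A|.
  by rewrite size_map cardE [enum A]/enum_mem -enumT.
apply/eqP; rewrite eqn_leq; apply/andP; split.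
  apply/bigmax_leqP => A altA; rewrite -size_at.
  apply: (k_alternating_greedy_ub _ _ altA).
  by rewrite /s /word /subseq_at -map_comp; apply/map_subseq/filter_subseq.
have [t sub_t [alt_t sz_t]] : exists2 t, subseq t s &
    k_alternating k t /\ size t = (greedy k true 0 s).+1.
  rewrite /s; case: (map _ _) (size_map val (word w)) => [|y u _].
    by rewrite size_map size_enum_ord.
  have [/(_ y)[p [t [sub _ alt sz]]] _] := greedy_attained u k0.
  exists (p :: t) => //; split=> //.
  (* Since [0 < k], no turn is possible from the held value 0, so the first letter becomes the peak;
     it accounts for the extra one. *)
  by rewrite /= sz max0n ifF //; lia.
rewrite -sz_t.
have [r sub_r t_def] : exists2 r : seq 'I_n.+1, subseq r (enum 'I_n.+1) &
    t = [seq val (w i) | i <- r].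
  move: sub_t; rewrite /s /word -map_comp => /subseqP[b sb ->].
  exists (mask b (enum 'I_n.+1)); last by rewrite map_mask.
  exact: mask_subseq.
have at_r : subseq_at w [set i in r] = t.
  rewrite /subseq_at t_def; congr map.
  rewrite (eq_filter (a2 := mem r)); last by move=> i; rewrite inE.
  by move/(subseq_uniqP (enum_uniq _)): sub_r => {2}->.
rewrite -at_r size_at.
by apply: (leq_bigmax_cond (F := fun A : {set 'I_n.+1} => #|A|)); rewrite at_r.
Qed.

(** * Relays and their comparison with the greedy scan *)

(* [b = true] is the high state of the relay. *)
Fixpoint switches (T : Type) (lo hi : pred T) (b : bool) (s : seq T) : nat :=
  if s is y :: s' then
    let b' := if b then ~~ lo y else hi y in (b != b') + switches lo hi b' s'
  else 0.

Definition below (a : nat) : pred nat := fun x => x < a.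
Definition above (a K : nat) : pred nat := fun x => a + K <= x.

(* [c] encodes the initial states of the relays: those with [a < c] are high. *)
Definition total_switches (A K c : nat) (s : seq nat) : nat :=
  \sum_(a < A) switches (below a) (above a K) (a < c) s.

(* The evolution, on reading the value [y], of the threshold [c] such that the
   relays in the high state are those with [a < c]. *)
Definition play (K c y : nat) : nat := maxn (minn c y.+1) (y.+1 - K).

Lemma sum_ltn_neq A c d : c <= A -> d <= A ->
  \sum_(a < A) ((a < c) != (a < d) : nat) = (c - d) + (d - c).
Proof.
move=> cA dA.
suff -> : \sum_(a < A) ((a < c) != (a < d) : nat)
    = (minn A c - minn A d) + (minn A d - minn A c) by lia.
elim: A {cA dA} => [|A IH]; first by rewrite big_ord0 !min0n.
by rewrite big_ord_recr /= IH; lia.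
Qed.

(** A high relay stays high iff [a <= y] and a low one rises iff [a + K <= y], so the high relays
    again form an initial segment. Those that switch lie between its two endpoints. *)
Lemma total_switches_cons A K c y s : c <= A -> y < A ->
  total_switches A K c (y :: s) =
  (c - play K c y) + (play K c y - c) + total_switches A K (play K c y) s.
Proof.
move=> cA yA; have pA : play K c y <= A by rewrite /play; lia.
rewrite /total_switches -(sum_ltn_neq cA pA) -big_split.
apply: eq_bigr => a _ /=.
suff -> : (if a < c then ~~ below a y else above a K y) = (a < play K c y) by [].
by case: ifP; rewrite /below /above /play; lia.
Qed.

(** At a peak the endpoints for widths [k.+1] and [k] are one apart, and at a valley they coincide.
    Each turn therefore costs the width [k] exactly one more switch; without a turn both endpoints
    move equally. The bound [k <= m] prevents truncation in [m - k]. *)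
Lemma greedy_switches A k s : all (gtn A) s ->
  (forall m, k <= m < A -> greedy k.+1 true m s + total_switches A k.+1 (m - k) s
     = total_switches A k (m.+1 - k) s)
  /\ (forall m, m < A -> greedy k.+1 false m s + total_switches A k.+1 m.+1 s
     = total_switches A k m.+1 s).
Proof.
elim: s => [_|y s IH /=].
  by split=> m _; rewrite /= /total_switches !big1.
case/andP=> yA /IH[IHp IHv]; split=> m m_bnd.
- rewrite !total_switches_cons; try lia.
  case: ifP => h.
    have -> : play k.+1 (m - k) y = y.+1 by rewrite /play; lia.
    have -> : play k (m.+1 - k) y = y.+1 by rewrite /play; lia.
    by have := IHv y yA; lia.
  have -> : play k.+1 (m - k) y = maxn m y - k by rewrite /play; lia.
  have -> : play k (m.+1 - k) y = (maxn m y).+1 - k by rewrite /play; lia.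
  by have := IHp (maxn m y); lia.
- rewrite !total_switches_cons; try lia.
  case: ifP => h.
    have -> : play k.+1 m.+1 y = y - k by rewrite /play; lia.
    have -> : play k m.+1 y = y.+1 - k by rewrite /play; lia.
    by have := IHp y; lia.
  have -> : play k.+1 m.+1 y = (minn m y).+1 by rewrite /play; lia.
  have -> : play k m.+1 y = (minn m y).+1 by rewrite /play; lia.
  by have := IHv (minn m y); lia.
Qed.

(* Until a value [>= k] is read, the first element of the subsequence has been
   counted by [greedy] but no relay of width [k] has switched. *)
Lemma greedy_switches0 A k m s : all (gtn A) s -> has (leq k) s -> m <= k ->
  (greedy k.+1 true m s).+1 + total_switches A k.+1 0 s = total_switches A k 0 s.
Proof.
elim: s m => //= y s IH m /andP[yA sA] hs mk; rewrite ifF; last by lia.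
rewrite !total_switches_cons //.
case: leqP hs => /= [ky _|yk hs].
  have -> : play k.+1 0 y = y - k by rewrite /play; lia.
  have -> : play k 0 y = y.+1 - k by rewrite /play; lia.
  have -> : maxn m y = y by lia.
  by have := (proj1 (greedy_switches k sA)) y; lia.
have -> : play k.+1 0 y = 0 by rewrite /play; lia.
have -> : play k 0 y = 0 by rewrite /play; lia.
by rewrite -(IH (maxn m y)) //; lia.
Qed.

Lemma as_k_switches n k (w : {perm 'I_n.+1}) : k <= n ->
  as_k k.+1 w + total_switches n.+1 k.+1 0 (map val (word w))
  = total_switches n.+1 k 0 (map val (word w)).
Proof.
move=> kn; rewrite as_k_greedy // greedy_switches0 //.
  by apply/allP => _ /mapP[i _ ->]; exact: ltn_ord.
(* The largest value [n] occurs in every word and is at least [k]. *)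
apply/hasP; exists n => //; apply/mapP; exists ord_max => //.
by apply/mapP; exists (w^-1%g ord_max); rewrite ?mem_enum ?permKV.
Qed.

(** * Switches as changes between adjacent relevant letters *)

Lemma switches_map (T U : Type) (f : T -> U) (lo hi : pred U) b s :
  switches lo hi b (map f s) = switches (preim f lo) (preim f hi) b s.
Proof. by elim: s b => //= y s IHs b; rewrite IHs. Qed.

Lemma switches_filter (T : Type) (lo hi : pred T) b s :
  switches lo hi b s = switches lo hi b (filter (predU lo hi) s).
Proof.
elim: s b => //= y s IHs b; rewrite IHs.
by case: b; case loy: (lo y); case hiy: (hi y) => //=; rewrite ?loy ?hiy.
Qed.

(** When every letter is low or high, the state after a letter depends on that letter alone. *)
Lemma switches_nth (T : Type) (x0 : T) (lo hi : pred T) b x s :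
  (forall y, lo y -> hi y = false) -> all (predU lo hi) (x :: s) ->
  switches lo hi b (x :: s) = (b != hi x)
    + \sum_(j < size s) (hi (nth x0 (x :: s) j) != hi (nth x0 (x :: s) j.+1)).
Proof.
move=> dis.
have next c y : lo y || hi y -> (if c then ~~ lo y else hi y) = hi y.
  by case: c => //; case: (boolP (lo y)) => [/dis->|_].
elim: s b x => [|y s IHs] b x /=.
  by rewrite andbT => /next->; rewrite big_ord0.
case/andP=> /next-> all_s; have := IHs (hi x) y all_s; rewrite /= => ->.
by rewrite big_ord_recl.
Qed.

(** * Uniform order of the letters of [O] *)

Section Average.
Variables (n : nat) (O : pred 'I_n.+1).
Implicit Types (w : {perm 'I_n.+1}) (x y : 'I_n.+1).

Definition subword w : seq 'I_n.+1 := filter O (word w).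

Lemma word_uniq w : uniq (word w).
Proof. by rewrite map_inj_uniq ?enum_uniq //; exact: perm_inj. Qed.

Lemma mem_word w x : x \in word w.
Proof. by apply/mapP; exists (w^-1%g x); rewrite ?mem_enum ?permKV. Qed.

Lemma mem_subword w : subword w =i O.
Proof. by move=> x; rewrite mem_filter mem_word andbT. Qed.

Lemma size_subword w : size (subword w) = #|O|.
Proof.
rewrite -(card_uniqP _) ?filter_uniq ?word_uniq //.
by apply: eq_card => x; rewrite mem_subword.
Qed.

Lemma subword_mul w (p : {perm 'I_n.+1}) : (forall x, O (p x) = O x) ->
  subword (w * p)%g = map p (subword w).
Proof.
move=> pO; have wordM : word (w * p)%g = map p (word w).
  by rewrite /word -map_comp; apply: eq_map => i; rewrite /= permM.
by rewrite /subword wordM filter_map; congr map; exact: eq_filter.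
Qed.

Lemma tperm_closed x x' : O x -> O x' -> forall y, O (tperm x x' y) = O y.
Proof. by move=> Ox Ox' y; case: tpermP => [->|->|]; rewrite ?Ox ?Ox'. Qed.

Definition at_pos w j x := nth ord0 (subword w) j == x.

Lemma at_pos_mul w (p : {perm 'I_n.+1}) j x : (forall x, O (p x) = O x) ->
  j < #|O| -> at_pos (w * p)%g j (p x) = at_pos w j x.
Proof.
move=> pO jO; rewrite /at_pos subword_mul // (nth_map ord0) ?size_subword //.
by rewrite (inj_eq perm_inj).
Qed.

Lemma sum_at_pos w j (P : pred 'I_n.+1) :
  \sum_(x | P x) at_pos w j x = P (nth ord0 (subword w) j).
Proof.
rewrite big_mkcond (bigD1 (nth ord0 (subword w) j)) //= /at_pos eqxx.
rewrite big1 ?addn0; first by case: (P _).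
by move=> x; rewrite eq_sym => /negbTE->; case: (P x).
Qed.

Lemma in_subword w j : j < #|O| -> O (nth ord0 (subword w) j).
Proof.
move=> jO; have := mem_subword w (nth ord0 (subword w) j).
by rewrite mem_nth ?size_subword // => /esym.
Qed.

(* Multiplying [w] by a transposition of two elements of [O] permutes the
   permutations and exchanges these elements in the subword. *)
Lemma count_at_pos j x : j < #|O| -> O x ->
  #|O| * (\sum_(w : {perm 'I_n.+1}) at_pos w j x) = n.+1`!.
Proof.
move=> jO Ox; rewrite -sum_nat_const.
rewrite (eq_bigr (fun y => \sum_(w : {perm 'I_n.+1}) (at_pos w j y : nat)));
  last first.
  move=> y Oy; rewrite (reindex_inj (mulIg (tperm x y))) /=.
  apply: eq_bigr => w _.
  by have := at_pos_mul w y (tperm_closed Ox Oy) jO; rewrite tpermR => ->.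
rewrite exchange_big /= (eq_bigr (fun=> 1)) => [|w _].
  by rewrite sum_nat_const muln1 card_Sn.
by rewrite (sum_at_pos _ _ O) // in_subword.
Qed.

(** Transposing [y] with another letter of [O] distinct from [x] leaves [x] in place, so the count
    is the same for all [#|O|.-1] choices of [y]. *)
Lemma count_at_pos2 j x y : j.+1 < #|O| -> O x -> O y -> x != y ->
  #|O| * (#|O|.-1 *
    \sum_(w : {perm 'I_n.+1}) (at_pos w j x && at_pos w j.+1 y)) = n.+1`!.
Proof.
move=> jO Ox Oy xy; rewrite -(count_at_pos (ltnW jO) Ox); congr (_ * _).
have -> : #|O|.-1 = #|[pred z | O z & z != x]|.
  by rewrite [#|O|](cardD1 x) unfold_in Ox; apply: eq_card => z; rewrite !inE andbC.
rewrite -sum_nat_const.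
rewrite (eq_bigr (fun z => \sum_(w : {perm 'I_n.+1})
    (at_pos w j x && at_pos w j.+1 z : nat))); last first.
  move=> z /andP[Oz zx]; rewrite (reindex_inj (mulIg (tperm y z))) /=.
  apply: eq_bigr => w _; congr nat_of_bool.
  have tO := tperm_closed Oy Oz.
  have := at_pos_mul w z tO jO; have := at_pos_mul w x tO (ltnW jO).
  by rewrite tpermR tpermD // 1?eq_sym // => -> ->.
rewrite exchange_big /=; apply: eq_bigr => w _.
case: (boolP (at_pos w j x)) => [/eqP jx|_]; last by rewrite big1.
rewrite sum_at_pos; congr nat_of_bool.
have Oj := in_subword w jO; rewrite unfold_in /= Oj -jx /=.
have uniq_sub : uniq (subword w) by rewrite filter_uniq // word_uniq.
by rewrite nth_uniq ?size_subword ?(ltnW jO) // (gtn_eqF (ltnSn j)).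
Qed.

Lemma count_pair j (P Q : pred 'I_n.+1) : j.+1 < #|O| ->
  subpred P O -> subpred Q O -> (forall x, P x -> Q x = false) ->
  #|O| * (#|O|.-1 *
    \sum_(w : {perm 'I_n.+1})
      (P (nth ord0 (subword w) j) && Q (nth ord0 (subword w) j.+1)))
  = #|P| * #|Q| * n.+1`!.
Proof.
move=> jO PO QO PQ.
have -> : \sum_(w : {perm 'I_n.+1})
    (P (nth ord0 (subword w) j) && Q (nth ord0 (subword w) j.+1))
  = \sum_(x | P x) \sum_(y | Q y) \sum_(w : {perm 'I_n.+1})
      (at_pos w j x && at_pos w j.+1 y).
  under [RHS]eq_bigr do rewrite exchange_big.
  rewrite exchange_big; apply: eq_bigr => w _.
  rewrite -mulnb -(sum_at_pos w j P) -(sum_at_pos w j.+1 Q).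
  rewrite big_distrl; apply: eq_bigr => x _; rewrite big_distrr.
  by apply: eq_bigr => y _; rewrite /= mulnb.
rewrite -[RHS]mulnA -[RHS]sum_nat_const !big_distrr; apply: eq_bigr => x Px.
rewrite -[RHS]sum_nat_const !big_distrr; apply: eq_bigr => y Qy.
apply: count_at_pos2; [by []|exact: PO|exact: QO|].
by apply/eqP => xy; move: (PQ _ Px); rewrite xy => /negP; apply.
Qed.

Lemma count_first (P : pred 'I_n.+1) : 0 < #|O| -> subpred P O ->
  #|O| * \sum_(w : {perm 'I_n.+1}) P (nth ord0 (subword w) 0) = #|P| * n.+1`!.
Proof.
move=> O0 PO.
under eq_bigr do rewrite -(sum_at_pos _ _ P).
rewrite exchange_big -[RHS]sum_nat_const big_distrr; apply: eq_bigr => x Px.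
by apply: count_at_pos => //; exact: PO.
Qed.

End Average.

(** * Averaging the relay switches *)

(** With [l] low and [h] high letters, the first is high with probability h/(l+h), and each of the
    l+h-1 adjacent pairs is mixed with probability 2lh/((l+h)(l+h-1)). *)
Lemma sum_switches n (lo hi : pred 'I_n.+1) : (forall y, lo y -> hi y = false) ->
  0 < #|lo| + #|hi| ->
  (#|lo| + #|hi|) * \sum_(w : {perm 'I_n.+1}) switches lo hi false (word w)
  = #|hi| * (2 * #|lo| + 1) * n.+1`!.
Proof.
move=> dis; pose O : pred 'I_n.+1 := predU lo hi.
have cardO : #|lo| + #|hi| = #|O|.
  rewrite -cardUI [X in _ + X]eq_card0 ?addn0 // => x.
  by rewrite inE /= !unfold_in; apply/andP => -[/dis->].
rewrite cardO => O0.
have loO : subpred lo O by move=> x; rewrite /O /= => ->.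
have hiO : subpred hi O by move=> x; rewrite /O /= => ->; rewrite orbT.
have dis' x : hi x -> lo x = false.
  by move=> hx; apply/negP => /dis; rewrite hx.
have E w : switches lo hi false (word w) =
    hi (nth ord0 (subword O w) 0) + \sum_(j < #|O|.-1)
    ((lo (nth ord0 (subword O w) j) && hi (nth ord0 (subword O w) j.+1))
     + (hi (nth ord0 (subword O w) j) && lo (nth ord0 (subword O w) j.+1))).
  rewrite switches_filter -/O -/(subword O w).
  have := size_subword O w; have : all O (subword O w) by exact: filter_all.
  case: (subword O w) => [|x s] alls szO; first by rewrite -szO in O0.
  rewrite (switches_nth ord0) // -szO; congr addn.
    by rewrite /=; case: (hi x).
  have cls i : i < size (x :: s) ->
      lo (nth ord0 (x :: s) i) = ~~ hi (nth ord0 (x :: s) i).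
    move=> /(mem_nth ord0) /(allP alls); rewrite /O /=.
    by case hi_i: (hi _); [rewrite (dis' _ hi_i)|rewrite orbF].
  apply: eq_bigr => j _.
  have js : j.+1 < size (x :: s) by exact: ltn_ord.
  rewrite !cls //; last exact: ltnW.
  by case: (hi (nth _ _ j)); case: (hi (nth _ _ j.+1)).
have [f fE] : exists f, n.+1`! = f by exists n.+1`!.
rewrite fE; under eq_bigr do rewrite E.
rewrite big_split [LHS]mulnDr [X in X + _](count_first O0 hiO) fE exchange_big /=.
(* A single letter has no adjacent pair, and the factor [#|O|.-1] could not be cancelled. *)
have [O1|O1] := leqP #|O| 1.
  rewrite (_ : #|O|.-1 = 0); last by lia.
  by rewrite big_ord0; have [->|->] : #|lo| = 0 \/ #|hi| = 0; lia.
apply/eqP; rewrite -(eqn_pmul2l (_ : 0 < #|O|.-1)); last by lia.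
rewrite mulnDr [X in _ + X]mulnCA !big_distrr /=.
rewrite (eq_bigr (fun=> 2 * (#|lo| * #|hi| * f))) => [|j _].
  by rewrite sum_nat_const card_ord; apply/eqP; lia.
have jO : j.+1 < #|O| by have := ltn_ord j; lia.
rewrite big_split /= !mulnDr (count_pair jO loO hiO dis) fE.
by rewrite (count_pair jO hiO loO dis') fE (mulnC #|hi|); lia.
Qed.

Lemma sum_window N A : N <= A ->
  6 * \sum_(a < A) (N - a) * (2 * a + 1) = N * (N + 1) * (2 * N + 1).
Proof.
move=> NA; rewrite -(big_mkord xpredT (fun a => (N - a) * (2 * a + 1))).
rewrite (big_cat_nat (leq0n N) NA) /= [X in _ + X]big_nat.
rewrite [X in _ + X]big1 ?addn0 => [|a /andP[Na _]]; last first.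
  by rewrite (eqP Na).
(* The cubic term of the closed form stands on the left to avoid subtraction. *)
have partial B : B <= N -> 6 * (\sum_(0 <= a < B) (N - a) * (2 * a + 1))
    + 4 * (B * B * B) = 6 * (N * B * B) + 3 * (B * B) + B.
  elim: B => [|B IH] BN; first by rewrite big_geq //; lia.
  rewrite big_nat_recr //=; have := IH (ltnW BN).
  have [d ->] : exists d, N = B.+1 + d by exists (N - B.+1); lia.
  by rewrite (_ : B.+1 + d - B = d.+1); lia.
by have := partial N (leqnn N); lia.
Qed.

Lemma card_ord_lt n c : #|[pred x : 'I_n | x < c]| = minn n c.
Proof.
rewrite -sum1_card big_mkcond /=; under eq_bigr do rewrite inE.
elim: n => [|n IH]; first by rewrite big_ord0 min0n.
by rewrite big_ord_recr /= IH; case: ifP; lia.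
Qed.

Lemma card_ord_geq n c : #|[pred x : 'I_n | c <= x]| = n - c.
Proof.
rewrite -sum1_card big_mkcond /=; under eq_bigr do rewrite inE.
elim: n => [|n IH]; first by rewrite big_ord0.
by rewrite big_ord_recr /= IH; case: ifP; lia.
Qed.

Lemma sum_window_switches n K (a : 'I_n.+1) : K <= n ->
  (n.+1 - K) * \sum_(w : {perm 'I_n.+1})
     switches (below a) (above a K) false (map val (word w))
  = (n.+1 - K - a) * (2 * a + 1) * n.+1`!.
Proof.
move=> Kn; set N := n.+1 - K; have N0 : 0 < N by lia.
under eq_bigr do rewrite switches_map.
set lo := preim val (below a); set hi := preim val (above a K).
have dis y : lo y -> hi y = false by rewrite /lo /hi /below /above /=; lia.
have clo : #|lo| = a by rewrite card_ord_lt; have := ltn_ord a; lia.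
have chi : #|hi| = N - a by rewrite card_ord_geq; lia.
have := sum_switches dis; rewrite clo chi.
(* For [a <= N] there are [N] relevant letters in all; for larger [a] none is high and both sides
   vanish. *)
case: (leqP a N) => aN; first by rewrite subnKC // => /(_ N0).
rewrite (_ : N - a = 0) ?addn0; last by lia.
move=> /(_ (leq_trans N0 (ltnW aN))) /eqP.
by rewrite mul0n muln_eq0 => /orP[|/eqP->]; [lia|rewrite muln0].
Qed.

Lemma sum_total_switches n K : K <= n ->
  6 * \sum_(w : {perm 'I_n.+1}) total_switches n.+1 K 0 (map val (word w))
  = (n.+1 - K + 1) * (2 * (n.+1 - K) + 1) * n.+1`!.
Proof.
move=> Kn; set N := n.+1 - K; have N0 : 0 < N by lia.
apply/eqP; rewrite -(eqn_pmul2l N0) mulnCA !mulnA.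
rewrite -(@sum_window N n.+1) ?leq_subr // -!mulnA eqn_pmul2l //.
rewrite exchange_big big_distrr big_distrl /=.
by apply/eqP/eq_bigr => a _; exact: sum_window_switches.
Qed.

Unset Implicit Arguments.
Local Open Scope ring_scope.

Theorem theorem1p1 (n k : nat) (hk : (1 <= k)%N) (hn : (k + 1 <= n)%N) :
  ((\sum_(w : {perm 'I_n}) as_k k w)%:R / (n`!)%:R : rat)
  = (4 * (n - k) + 5)%:R / 6.
Proof.
case: n hn => [|n] hn; first by lia.
case: k hk hn => // k _ hn.
have sum_as : (6 * (\sum_(w : {perm 'I_n.+1}) as_k k.+1 w)
    = (4 * (n.+1 - k.+1) + 5) * n.+1`!)%N.
  have kn : (k <= n)%N by lia.
  have S1 := @sum_total_switches n k.+1 ltac:(lia).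
  have := sum_total_switches kn.
  under eq_bigr do rewrite -(as_k_switches _ kn).
  rewrite big_split /= mulnDr S1.
  have -> : (n.+1 - k = (n.+1 - k.+1).+1)%N by lia.
  (* The identity is (N+2)(2N+3) - (N+1)(2N+1) = 4N+5. *)
  by move: (n.+1 - k.+1)%N (n.+1`!) (\sum_w _)%N => N f S; nia.
have f0 : (n.+1`!)%:R != 0 :> rat by rewrite pnatr_eq0 -lt0n fact_gt0.
apply/eqP; rewrite eqr_div // -!natrM; apply/eqP; congr (_%:R).
by rewrite -sum_as mulnC.
Qed.
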